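(* Let $n\ge 1$ be an integer, $\epsilon>0$, and let $G=([n],E)$ be an undirected simple graph. Let $x(t)=(x_1(t),\dots,x_n(t))'$, $t=0,1,2,\dots$, evolve according to the garbage disposal game with threshold $\epsilon$ on $G$ (defined in the context), started from nonnegative initial values $x_i(0)$, $i\in[n]$. Assume that (i) the graph $G$ is connected and is not a star graph, and (ii) the graph $G_s$ is $\epsilon$-trivial for some time $s\ge 0$. Then, for every $i\in[n]$, $$x_i(t)\longrightarrow \frac1n\sum_{k\in[n]}x_k(0)\qquad\text{as } t\to\infty .$$
   Context: Notation: $[n]=\{1,\dots,n\}$; $\mathbb 1\{\cdot\}$ is the indicator. Garbage disposal game with threshold $\epsilon>0$ on an undirected simple graph $G=([n],E)$: $x_i(t)\ge 0$ is the amount of garbage of agent $i$ at time $t\in\{0,1,2,\dots\}$. At each time $t$ let $E_t=\{(i,j)\in E: |x_i(t)-x_j(t)|\le\epsilon\}$ (edges are unordered pairs, and $|E_t|$ is the number of edges), $G_t=([n],E_t)$, and $N_i(t)=\{j\in[n]:(i,j)\in E_t\}$. The update rule, for all $i\in[n]$, is: if $E_t\neq\emptyset$, $$x_i(t+1)=\frac{1}{|E_t|}\sum_{j\in N_i(t)}x_j(t)+\Big(1-\frac{|N_i(t)|}{|E_t|}\Big)x_i(t),$$ and $x_i(t+1)=x_i(t)$ if $E_t=\emptyset$. The initial values $x_i(0)$ are nonnegative real-valued random variables; given them the dynamics is deterministic, and statements are understood pointwise (for each realization). For $\delta>0$, the graph $G_t$ is called $\delta$-trivial if the distance between any two of its vertices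 is at most $\delta$, where the distance between $i$ and $j$ is that between their values at time $t$; that is, $|x_i(t)-x_j(t)|\le\delta$ for all $i,j\in[n]$. A star graph is a graph consisting of one center vertex joined to all the other vertices, with no other edges. *)

(* Defs.v *)
From mathcomp Require Import all_boot all_order all_algebra.
From mathcomp Require Import reals.

Set Implicit Arguments.
Unset Strict Implicit.
Unset Printing Implicit Defensive.

Import Order.TTheory GRing.Theory Num.Theory.

Local Open Scope ring_scope.

(* Graphs on a finite vertex type are given by their adjacency relation. *)
Definition simple_graph (V : finType) (e : rel V) : Prop :=
  symmetric e /\ irreflexive e.

Definition connected_graph (V : finType) (e : rel V) : Prop :=
  forall i j : V, connect e i j.

(* The one-vertex graph counts as a star. *)
Definition star_graph (V : finType) (e : rel V) : Prop :=
  exists c : V, forall i j : V, e i j = (i != j) && ((i == c) || (j == c)).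

Definition edges (V : finType) (e : rel V) : {set {set V}} :=
  [set [set p.1; p.2] | p : V * V & e p.1 p.2].

Definition neighbors (V : finType) (e : rel V) (i : V) : {set V} :=
  [set j | e i j].

(* Adjacency in G_t, where x is the vector of values at time t. *)
Definition active (R : realType) (V : finType) (e : rel V) (eps : R)
    (x : V -> R) : rel V :=
  fun i j => e i j && (`|x i - x j| <= eps).

Definition garbage_step (R : realType) (V : finType) (e : rel V) (eps : R)
    (x : V -> R) (i : V) : R :=
  let Et := edges (active e eps x) in
  let Ni := neighbors (active e eps x) i in
  if Et == set0 then x i
  else (#|Et|%:R)^-1 * \sum_(j in Ni) x j + (1 - #|Ni|%:R / #|Et|%:R) * x i.

Definition garbage_game (R : realType) (V : finType) (e : rel V) (eps : R)
    (x : nat -> V -> R) : Prop :=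
  forall (t : nat) (i : V), x t.+1 i = garbage_step e eps (x t) i.

(* The distance between two vertices is that between their values, so
   triviality of G_t only depends on the values x at time t. *)
Definition trivial_profile (R : realType) (V : finType) (delta : R)
    (x : V -> R) : Prop :=
  forall i j : V, `|x i - x j| <= delta.

(* Main.v *)
(** As soon as all values lie within [eps] of each other, every edge is active
    forever and the dynamics is the linear iteration of [1 - L / m], where [L]
    is the Laplacian of the graph and [m] its number of edges.  In a connected
    graph that is not a star every vertex has degree less than [m], so the
    diagonal and edge entries of this stochastic matrix are at least [1 / m] and
    the entries of its [n]-th power are at least [c = (1 / m) ^ n].  Hence the
    spread of the values shrinks by a factor [1 - c] every [n] steps; as each
    step preserves the sum, all values tend to the initial mean. *)
Require Import Defs.
From mathcomp Require Import all_boot all_order all_algebra.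
From mathcomp Require Import all_classical all_reals all_analysis.
From mathcomp Require Import ring lra.
Set Implicit Arguments.
Unset Strict Implicit.
Unset Printing Implicit Defensive.
Import Order.TTheory GRing.Theory Num.Theory.
Import numFieldNormedType.Exports.
Local Open Scope ring_scope.

(** Written with differences along edges, so that the update is [x - L x / m] without a case split
    on the absence of edges. *)
Definition diffusion (R : realType) (V : finType) (a : rel V) (x : V -> R)
    (i : V) : R :=
  x i + #|edges a|%:R^-1 * \sum_(j | a i j) (x j - x i).

(* When no edge is active both sides are [x i], because [0^-1 = 0]. *)
Lemma garbage_stepE (R : realType) (V : finType) (e : rel V) (eps : R)
    (x : V -> R) (i : V) :
  garbage_step e eps x i = diffusion (active e eps x) x i.
Proof.
rewrite /garbage_step /diffusion; set a := active e eps x.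
case: eqP => [->|_]; first by rewrite cards0 invr0 mul0r addr0.
rewrite sumrB (eq_bigl (a i)); last by move=> j; rewrite inE.
rewrite sumr_const cardsE -[x i *+ _]mulr_natl; ring.
Qed.

Lemma eq_diffusion (R : realType) (V : finType) (a b : rel V) (x : V -> R) :
  a =2 b -> diffusion a x =1 diffusion b x.
Proof.
move=> ab i; rewrite /diffusion; have -> : edges a = edges b.
  by apply/setP => A; apply/imsetP/imsetP => -[p abp ->]; exists p => //;
    move: abp; rewrite !inE ab.
by rewrite (eq_bigl (b i)) // => j; rewrite ab.
Qed.

(** This symmetry turns lower bounds on the update into upper bounds. *)
Lemma diffusionN (R : realType) (V : finType) (a : rel V) (x : V -> R) (i : V) :
  diffusion a (\- x) i = - diffusion a x i.
Proof.
rewrite /diffusion (eq_bigr (fun j => - (x j - x i))).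
  by rewrite sumrN mulrN opprD.
by move=> j _ /=; ring.
Qed.

(** Each edge contributes [x j - x i] at one end and its opposite at the other. *)
Lemma sum_diffusion (R : realType) (V : finType) (a : rel V) (x : V -> R) :
  symmetric a -> \sum_i diffusion a x i = \sum_i x i.
Proof.
move=> a_sym; rewrite big_split /= -mulr_sumr.
suff -> : \sum_i \sum_(j | a i j) (x j - x i) = 0 by rewrite mulr0 addr0.
under eq_bigr do rewrite sumrB.
rewrite sumrB (exchange_big_dep xpredT) //=.
apply/eqP; rewrite subr_eq0; apply/eqP.
by apply: eq_bigr => i _; apply: eq_bigl => j; rewrite a_sym.
Qed.

(** The edges at [i] inject into all edges. If they were all of them, every edge would touch [i],
    and connectedness would make [i] the center of a star. *)
Lemma degree_lt_edges (V : finType) (e : rel V) (i : V) :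
  simple_graph e -> connected_graph e -> ~ star_graph e ->
  (#|e i| < #|edges e|)%N.
Proof.
move=> [e_sym e_irr] e_conn e_nstar.
have inj : {in e i &, injective (fun j => [set i; j])}.
  move=> j k; rewrite !unfold_in => eij eik /setP /(_ j).
  rewrite !inE eqxx orbT; case: (j =P i) => [ji|_ /esym /eqP //].
  by rewrite ji e_irr in eij.
rewrite -(card_in_imset inj); apply: proper_card.
rewrite properE; apply/andP; split.
  apply/fintype.subsetP => _ /imsetP[j eij ->].
  by apply/imsetP; exists (i, j); rewrite ?inE.
apply/negP => /fintype.subsetP sub; apply: e_nstar; exists i.
have touch u v : e u v -> (u == i) || (v == i).
  move=> euv; have /sub /imsetP[w _ /setP /(_ i)] : [set u; v] \in edges e.
    by apply/imsetP; exists (u, v); rewrite ?inE.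
  by rewrite !inE eqxx /= ![i == _]eq_sym.
(* The first edge on a path from [j] to [i] must touch [i], and [j] is not [i], so its other end
   is. *)
have ei j : i != j -> e i j.
  move=> ij; have /connectP[[|k p] /=] := e_conn j i.
    by move=> _ eji; rewrite eji eqxx in ij.
  move=> /andP[ejk _] _; move: (touch _ _ ejk).
  by rewrite eq_sym (negPf ij) /= => /eqP <-; rewrite e_sym.
move=> u v; apply/idP/idP => [euv|/andP[uv /orP[/eqP ui|/eqP vi]]].
- by rewrite touch // andbT; apply/eqP => uv; rewrite uv e_irr in euv.
- by rewrite ui ei // -ui.
- by rewrite vi e_sym ei // -vi eq_sym.
Qed.

Local Open Scope classical_set_scope.

Section Contraction.
Variables (R : realType) (V : finType) (e : rel V).
Hypotheses (e_simple : simple_graph e) (e_conn : connected_graph e)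
  (e_nstar : ~ star_graph e).

Let c : R := #|edges e|%:R^-1.

(** The excess of the new value over [b] combines the nonnegative excesses [x k - b], with weight
    [c] on each neighbor and [1 - c * #|e i|] on [i]; the degree bound makes the latter at least
    [c]. *)
Lemma diffusion_ge (x : V -> R) (b : R) (i j : V) :
  (forall k, b <= x k) -> (i == j) || e i j ->
  b + c * (x j - b) <= diffusion e x i.
Proof.
move=> bx ij; have d_lt := degree_lt_edges i e_simple e_conn e_nstar.
have m_gt0 : 0 < #|edges e|%:R :> R by rewrite ltr0n (leq_ltn_trans _ d_lt).
have c_gt0 : 0 < c by rewrite invr_gt0.
have cd : c * #|e i|%:R + c <= 1.
  by rewrite -[X in _ + X]mulr1 -mulrDr natr1 ler_pdivrMl // mulr1 ler_nat.
have -> : diffusion e x i =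
    b + (1 - c * #|e i|%:R) * (x i - b) + c * \sum_(k | e i k) (x k - b).
  by rewrite /diffusion -/c !sumrB !sumr_const -[x i *+ _]mulr_natl
    -[b *+ _]mulr_natl; ring.
have xb k : 0 <= x k - b by rewrite subr_ge0.
rewrite -addrA lerD2l; case/orP: ij => [/eqP <-|eij].
- apply: ler_wpDr; first by rewrite mulr_ge0 ?sumr_ge0 // ltW.
  by rewrite ler_wpM2r // lerBrDl.
- apply: ler_wpDl; first by rewrite mulr_ge0 // subr_ge0; lra.
  rewrite ler_wpM2l ?(ltW c_gt0) // (bigD1 j) //= ler_wpDr //.
  exact: sumr_ge0.
Qed.

Lemma diffusion_lb (x : V -> R) (b : R) :
  (forall k, b <= x k) -> forall i, b <= diffusion e x i.
Proof.
move=> bx i; have ii : (i == i) || e i i by rewrite eqxx.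
apply: le_trans (diffusion_ge bx ii).
by rewrite ler_wpDr // mulr_ge0 ?invr_ge0 ?subr_ge0 ?ler0n.
Qed.

Lemma diffusion_ub (x : V -> R) (b : R) :
  (forall k, x k <= b) -> forall i, diffusion e x i <= b.
Proof.
move=> xb i; rewrite -lerN2 -diffusionN.
by apply: diffusion_lb => k /=; rewrite lerN2.
Qed.

(** New values stay between the old minimum and maximum. With [r = eps] this keeps every edge
    active. *)
Lemma diffusion_trivial (x : V -> R) (r : R) :
  trivial_profile r x -> trivial_profile r (diffusion e x).
Proof.
move=> xr i j.
case: (@arg_minP _ _ _ i xpredT x) => // lo _ lo_min.
case: (@arg_maxP _ _ _ i xpredT x) => // hi _ hi_max.
have le_r := le_trans (ler_norm _) (xr hi lo).
have lb := diffusion_lb (fun k => lo_min k isT).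
have ub := diffusion_ub (fun k => hi_max k isT).
have := (lb i, ub i, lb j, ub j) => -[[[? ?] ?] ?].
by rewrite ler_norml; lra.
Qed.

Variable y : nat -> V -> R.
Hypothesis y_step : forall t, y t.+1 =1 diffusion e (y t).

Lemma iter_lb (b : R) (t k : nat) :
  (forall i, b <= y t i) -> forall i, b <= y (t + k) i.
Proof.
move=> by0; elim: k => [|k IHk] i; first by rewrite addn0.
by rewrite addnS y_step; apply: diffusion_lb.
Qed.

Lemma iter_ub (b : R) (t k : nat) :
  (forall i, y t i <= b) -> forall i, y (t + k) i <= b.
Proof.
move=> by0; elim: k => [|k IHk] i; first by rewrite addn0.
by rewrite addnS y_step; apply: diffusion_ub.
Qed.

Lemma iter_trivial (r : R) (t k : nat) :
  trivial_profile r (y t) -> trivial_profile r (y (t + k)).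
Proof.
move=> yr; elim: k => [|k IHk]; first by rewrite addn0.
by move=> i j; rewrite addnS !y_step; apply: diffusion_trivial.
Qed.

(* The path may be shorter than [k]: the walk can wait at its end. *)
Lemma iter_ge_path (b : R) (t k : nat) (i : V) (p : seq V) :
  (forall j, b <= y t j) -> path e i p -> (size p <= k)%N ->
  b + c ^+ k * (y t (last i p) - b) <= y (t + k) i.
Proof.
move=> by0; have c_ge0 : 0 <= c by rewrite invr_ge0.
elim: k i p => [|k IHk] i p pi.
  by rewrite leqn0 size_eq0 => /eqP -> /=; rewrite addn0 expr0; lra.
move=> sp; rewrite addnS y_step.
(* The path is read backwards in time: its first edge, or a wait at [i], accounts for the last
   update. *)
have [j [q [qj sq lq ij]]] : exists j q,
    [/\ path e j q, (size q <= k)%N, last j q = last i p & (i == j) || e i j].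
  case: p pi sp => [|j q] /= pi sp; first by exists i, [::]; rewrite eqxx.
  by move/andP: pi => [eij qj]; exists j, q; split; rewrite // eij orbT.
apply: le_trans (diffusion_ge (iter_lb k by0) ij).
rewrite lerD2l exprS -mulrA ler_wpM2l // lerBrDl -lq; exact: IHk.
Qed.

(** It is enough to move one end: every value rises above the old minimum by at least [c ^+ #|V|]
    times the old spread, while none exceeds the old maximum. *)
Lemma iter_contraction (r : R) (t : nat) :
  trivial_profile r (y t) ->
  trivial_profile ((1 - c ^+ #|V|) * r) (y (t + #|V|)).
Proof.
move=> yr i j.
case: (@arg_minP _ _ _ i xpredT (y t)) => // lo _ lo_min.
case: (@arg_maxP _ _ _ i xpredT (y t)) => // hi _ hi_max.
have {}lo_min k : y t lo <= y t k by apply: lo_min.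
have {}hi_max k : y t k <= y t hi by apply: hi_max.
have le_r := le_trans (ler_norm _) (yr hi lo).
have lb k : y t lo + c ^+ #|V| * (y t hi - y t lo) <= y (t + #|V|) k.
  have /connectP[p0 pk hi_last] := e_conn k hi.
  (* A path without repeated vertices has fewer than [#|V|] edges. *)
  move: hi_last; case/shortenP: pk => p pk up _ ->.
  apply: iter_ge_path => //; rewrite ltnW //.
  by have := max_card (mem (k :: p)); rewrite (card_uniqP up).
have ub := iter_ub #|V| hi_max.
have c_le1 : 0 <= 1 - c ^+ #|V|.
  rewrite subr_ge0 exprn_ile1 // ?invr_ge0 // invf_le1 ?ler1n ?ltr0n;
  by apply: leq_ltn_trans (degree_lt_edges i e_simple e_conn e_nstar).
apply: le_trans (ler_wpM2l c_le1 le_r).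
have := (lb i, ub i, lb j, ub j) => -[[[? ?] ?] ?].
by rewrite ler_norml mulrBl mul1r; lra.
Qed.

Lemma iter_contractionX (r : R) (t q : nat) :
  trivial_profile r (y t) ->
  trivial_profile ((1 - c ^+ #|V|) ^+ q * r) (y (t + q * #|V|)).
Proof.
move=> yr; elim: q => [|q IHq]; first by rewrite expr0 mul1r mul0n addn0.
by rewrite mulSn addnCA addnC exprS -mulrA; apply: iter_contraction.
Qed.

Lemma iter_cvg_trivial (r d : R) (t : nat) :
  0 < d -> trivial_profile r (y t) ->
  \forall k \near \oo, trivial_profile d (y k).
Proof.
move=> d_gt0 yr.
(* A vertex is needed to get [0 < #|edges e|] from the degree bound; without vertices the claim is
   vacuous. *)
have [[i _]|V0] := pselect (exists i : V, True); last first.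
  by apply: nearW => k i; case: V0; exists i.
have d_lt := degree_lt_edges i e_simple e_conn e_nstar.
have m_gt0 : (0 < #|edges e|)%N by apply: leq_ltn_trans d_lt.
have c_gt0 : 0 < c by rewrite invr_gt0 ltr0n.
have c_le1 : c <= 1 by rewrite invf_le1 ?ler1n ?ltr0n.
set l := 1 - c ^+ #|V|.
have l_ge0 : 0 <= l by rewrite subr_ge0 exprn_ile1 // ltW.
have l_lt1 : `|l| < 1 by rewrite ger0_norm // ltrBlDr ltrDl exprn_gt0.
have /cvgr0_norm_le /(_ _ d_gt0) [q _ /(_ q (leqnn q)) /= qd] :
    l ^+ k * r @[k --> \oo] --> 0.
  by rewrite -(mul0r r); apply: cvgM; [exact: cvg_expr|exact: cvg_cst].
exists (t + q * #|V|)%N => // k /= /subnKC <-; apply: iter_trivial => u v.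
apply: le_trans (iter_contractionX q yr u v) _.
exact: le_trans (ler_norm _) qd.
Qed.

End Contraction.

Theorem theorem1 (R : realType) (n : nat) (n_ge1 : (1 <= n)%N)
    (eps : R) (eps_gt0 : 0 < eps)
    (e : rel 'I_n) (e_simple : simple_graph e)
    (x : nat -> 'I_n -> R)
    (x0_ge0 : forall i : 'I_n, 0 <= x 0%N i)
    (x_game : garbage_game e eps x)
    (e_connected : connected_graph e)
    (e_not_star : ~ star_graph e)
    (eps_trivial : exists s : nat, trivial_profile eps (x s)) :
  forall i : 'I_n,
    x t i @[t --> \oo] --> n%:R^-1 * \sum_(k < n) x 0%N k.
Proof.
move=> i; have [s xs] := eps_trivial.
(* The sum is preserved from time 0 on, also before [s], because the active graph is always
   symmetric. *)
have sum_x t : \sum_k x t k = \sum_k x 0%N k.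
  elim: t => // t <-.
  under eq_bigr do rewrite x_game garbage_stepE.
  apply: sum_diffusion => u v.
  by rewrite /active distrC; case: e_simple => ->.
have stepE t : trivial_profile eps (x t) -> x t.+1 =1 diffusion e (x t).
  move=> xt k; rewrite x_game garbage_stepE; apply: eq_diffusion => u v.
  by rewrite /active xt andbT.
have x_trivial k : trivial_profile eps (x (s + k)%N).
  elim: k => [|k IHk]; first by rewrite addn0.
  by move=> u v; rewrite addnS !stepE //; apply: diffusion_trivial.
pose y k := x (s + k)%N.
have y_step t : y t.+1 =1 diffusion e (y t).
  by move=> k; rewrite /y addnS stepE.
rewrite -(cvg_shiftn s); apply/cvgrPdist_le => d d_gt0.
have : trivial_profile eps (y 0%N) by rewrite /y addn0.
move/(iter_cvg_trivial e_simple e_connected e_not_star y_step d_gt0).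
apply: filterS => k yk /=; rewrite addnC -(sum_x (s + k)%N) -/(y k).
have n_gt0 : 0 < n%:R :> R by rewrite ltr0n.
(* The gap between the mean and a value is an average of pairwise differences, each at most [d] in
   absolute value. *)
have -> : n%:R^-1 * \sum_u y k u - y k i = n%:R^-1 * \sum_u (y k u - y k i).
  rewrite sumrB sumr_const card_ord -[y k i *+ _]mulr_natl mulrBr mulrA.
  by rewrite mulVf ?mul1r // gt_eqF.
rewrite normrM normfV normr_nat ler_pdivrMl //.
apply: le_trans (ler_norm_sum _ _ _) _.
have : \sum_u `|y k u - y k i| <= \sum_(u < n) d.
  by apply: ler_sum => u _; apply: yk.
by rewrite sumr_const card_ord mulr_natl.
Qed.
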